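(* Let $\sigma=\pi[\alpha_1,\dots,\alpha_k]\in\mathcal{S}_n$ be a block-wise simple permutation, where $\pi\in\mathcal{S}_k$ is simple with $k\ge4$ and $\alpha_1,\dots,\alpha_k$ are block-wise simple. Let $P(\sigma)$ be the closed interval poset of $\sigma$ and let $\mu$ be its M\''obius function. Then for each element $I$ of $P(\sigma)$, $$\mu(I,[1,n])=\begin{cases}1 & \text{if } I=[1,n],\\ -1 & \text{if } I \text{ is a coatom of } P(\sigma),\\ k-1 & \text{if } I=\emptyset,\\ 0 & \text{otherwise,}\end{cases}$$ where $[1,n]=\{1,\dots,n\}$ is the maximum of $P(\sigma)$.
   Context: $\mathcal{S}_n$ is the set of permutations of $\{1,\dots,n\}$, written in one-line notation. An interval of $\pi=a_1\cdots a_n\in\mathcal{S}_n$ is a non-empty contiguous sequence of entries $a_ia_{i+1}\cdots a_{i+k}$ whose values form a set of consecutive integers; an interval is identified with its set of values $[a,b]=\{a,a+1,\dots,b\}$. The whole permutation and the single entries are the trivial intervals; all others are proper. A permutation is simple if it has no proper intervals. The closed interval poset of $\sigma\in\mathcal{S}_n$ is the poset whose elements are the empty set $\emptyset$ and all the intervals of $\sigma$ (viewed as sets of values), ordered by inclusion; its minimum is $\emptyset$ and its maximum is $[1,n]$. A coatom is an element covered by the maximum. Inflation: for $\pi\in\mathcal{S}_k$ and $\alpha_i\in\mathcal{S}_{n_i}$ ($n_i\ge1$, $1\le i\le k$), $\pi[\alpha_1,\dots,\alpha_k]\in\mathcal{S}_{n_1+\cdots+n_k}$ is the permutation obtained by replacing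 the $i$-th entry of $\pi$, for each $i$, by a block of $n_i$ consecutive positions and consecutive values that is order-isomorphic to $\alpha_i$, the blocks being in the same relative order (in values) as the entries of $\pi$. Example: $2413[213,21,132,1]=546\,98\,132\,7$. Block-wise simple permutations are defined recursively: (1) the permutation $1\in\mathcal{S}_1$ is block-wise simple; (2) a permutation is block-wise simple if it equals $\pi[\alpha_1,\dots,\alpha_k]$ for some simple $\pi\in\mathcal{S}_k$ with $k\ge 4$ and block-wise simple permutations $\alpha_1,\dots,\alpha_k$. No other permutations are block-wise simple. *)

(* Defs.v *)
From HB Require Import structures.
From mathcomp Require Import all_boot all_order all_algebra all_fingroup.

Set Implicit Arguments.
Unset Strict Implicit.
Unset Printing Implicit Defensive.

Import Order.TTheory GRing.Theory Num.Theory.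
Import Order.DefaultSetSubsetOrder.

Section Mobius.
Local Open Scope ring_scope.
Local Open Scope order_scope.
Context {disp : Order.disp_t} {T : finPOrderType disp}.
Implicit Types x y z : T.

Definition covers x y := (x < y) && ~~ [exists z : T, x < z < y].

(* [d] is recursion fuel; [mobiusxx], [mobius_lt] and [mobius_nle] below show
   that [#|T|] is enough for the defining recurrence to hold. *)
Fixpoint mobius_rec (d : nat) x y : int :=
  if d is d'.+1 then
    if x == y then 1%R
    else if x < y then (- \sum_(z : T | (x <= z < y)%O) mobius_rec d' x z)%R
    else 0%R
  else 0%R.

Definition mobius x y : int := mobius_rec #|T| x y.

Lemma mobius_rec_stable d e x y :
    (#|[pred z | (z < y)%O]| < d)%N -> (#|[pred z | (z < y)%O]| < e)%N ->
  mobius_rec d x y = mobius_rec e x y.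
Proof.
elim: d e y => [|d IHd] [|e] y //= ltd lte.
case: eqP => // _; case: ifP => // _; congr (- _)%R.
apply: eq_bigr => z /andP[_ zy].
have lez : (#|[pred t | (t < z)%O]| < #|[pred t | (t < y)%O]|)%N.
  apply: proper_card; apply/properP; split.
    by apply/subsetP => t; rewrite !inE => /lt_trans; apply.
  by exists z; rewrite !inE ?ltxx.
by apply: IHd; apply: leq_trans lez _; rewrite -ltnS.
Qed.

Lemma mobius_fuel y : (#|[pred z | (z < y)%O]| < #|T|)%N.
Proof.
apply: proper_card; apply/properP.
by split; [exact/subsetP | exists y; rewrite !inE ?ltxx].
Qed.

Lemma mobiusxx x : mobius x x = 1%R.
Proof.
rewrite /mobius; have : (0 < #|T|)%N by apply/card_gt0P; exists x.
by case: #|T| => //= n _; rewrite eqxx.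
Qed.

Lemma mobius_lt x y : x < y ->
  mobius x y = (- \sum_(z : T | (x <= z < y)%O) mobius x z)%R.
Proof.
move=> xy; rewrite /mobius.
rewrite (mobius_rec_stable (e := #|T|.+1)) ?ltnS ?(ltnW (mobius_fuel y)) //=.
  by rewrite (lt_eqF xy) xy.
exact: mobius_fuel.
Qed.

Lemma mobius_nle x y : ~~ (x <= y) -> mobius x y = 0%R.
Proof.
rewrite /mobius; case: #|T| => //= n; rewrite le_eqVlt negb_or.
by case/andP => /negPf -> /negPf ->.
Qed.

End Mobius.

Definition coatom {disp} {T : finTBPOrderType disp} (x : T) :=
  covers x (\top)%O.

(* Permutations of {1, ..., n} are elements [s] of ['S_n], acting on
   {0, ..., n-1}: [s p] is the entry (value) at position [p]. *)

Definition segment n (a b : 'I_n) : {set 'I_n} := [set x : 'I_n | a <= x <= b].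

Definition is_interval n (s : 'S_n) (I : {set 'I_n}) : bool :=
  [exists i : 'I_n, exists j : 'I_n, (i <= j) && (I == s @: segment i j)]
  && [exists a : 'I_n, exists b : 'I_n, I == segment a b].

Definition proper_interval n (s : 'S_n) (I : {set 'I_n}) : bool :=
  [&& is_interval s I, I != [set: 'I_n] & #|I| != 1].

Definition simple_perm n (s : 'S_n) : bool :=
  [forall I : {set 'I_n}, ~~ proper_interval s I].

Section IntervalPoset.
Context {n : nat} {s : 'S_n}.

Record interval_poset := IntervalPoset {
  interval_set :> {set 'I_n};
  _ : (interval_set == set0) || is_interval s interval_set
}.

HB.instance Definition _ := [isSub for interval_set].
HB.instance Definition _ := [Finite of interval_poset by <:].
HB.instance Definition _ :=
  [SubChoice_isSubPOrder of interval_poset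
     by <: with Order.SetSubsetOrder.subset_display].

Lemma interval_leE (I J : interval_poset) :
  (I <= J)%O = (interval_set I \subset interval_set J).
Proof. by []. Qed.

Fact interval_bot_subproof :
  (set0 == set0 :> {set 'I_n}) || is_interval s set0.
Proof. by rewrite eqxx. Qed.

Fact interval_top_subproof :
  ([set: 'I_n] == set0) || is_interval s [set: 'I_n].
Proof.
case: n s => [|m] t; first by apply/orP; left; apply/eqP/setP => -[].
have segT : segment ord0 ord_max = [set: 'I_m.+1].
  by apply/setP => x; rewrite !inE leq0n -ltnS ltn_ord.
apply/orP; right; apply/andP; split; apply/existsP; exists ord0;
  apply/existsP; exists ord_max; rewrite segT //=.
by rewrite eq_sym eqEcard subsetT (card_imset _ (@perm_inj _ t)) leqnn.
Qed.

Fact interval_le0 (I : interval_poset) :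
  (IntervalPoset interval_bot_subproof <= I)%O.
Proof. by rewrite interval_leE sub0set. Qed.

Fact interval_le1 (I : interval_poset) :
  (I <= IntervalPoset interval_top_subproof)%O.
Proof. by rewrite interval_leE subsetT. Qed.

HB.instance Definition _ := Order.hasBottom.Build _ interval_poset interval_le0.
HB.instance Definition _ := Order.hasTop.Build _ interval_poset interval_le1.

Lemma interval_botE : (\bot : interval_poset)%O = set0 :> {set 'I_n}.
Proof. by []. Qed.

Lemma interval_topE : (\top : interval_poset)%O = [set: 'I_n] :> {set 'I_n}.
Proof. by []. Qed.

End IntervalPoset.
Arguments interval_poset {n} s.

Section Inflation.
Variables (k : nat) (pi : 'S_k) (m : 'I_k -> nat) (alpha : forall i, 'S_(m i)).

(* [tagnat.sig1 p] is the block containing the position [p], and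
   [tagnat.sig2 p] the offset of [p] in that block (see [tagnat.rect]). *)
Definition inflate_val (p : 'I_(\sum_i m i)) : nat :=
  \sum_(i | pi i < pi (tagnat.sig1 p)) m i
    + alpha (tagnat.sig1 p) (tagnat.sig2 p).

Lemma inflate_val_lt p : inflate_val p < \sum_i m i.
Proof.
rewrite /inflate_val [ltnRHS](bigID [pred i | pi i < pi (tagnat.sig1 p)]) /=.
by rewrite ltn_add2l (bigD1 (tagnat.sig1 p)) ?ltnn //= ltn_addr.
Qed.

Definition inflate_fun p : 'I_(\sum_i m i) := Ordinal (inflate_val_lt p).

Lemma inflate_fun_inj : injective inflate_fun.
Proof.
have lt12 p q : pi (tagnat.sig1 p) < pi (tagnat.sig1 q) ->
    inflate_val p < inflate_val q.
  move=> lt; rewrite /inflate_val.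
  apply: ltn_addr.
  rewrite [ltnRHS](bigID [pred i | pi i < pi (tagnat.sig1 p)]) /=.
  rewrite [X in _ < X + _](eq_bigl (fun i => pi i < pi (tagnat.sig1 p))).
    by rewrite ltn_add2l (bigD1 (tagnat.sig1 p)) ?ltnn ?lt //= ltn_addr.
  move=> i /=; case: (ltnP (pi i) (pi (tagnat.sig1 p))) => h.
    by rewrite (ltn_trans h lt).
  by rewrite andbF.
move=> p q /(congr1 val) /= eqpq.
have e1 : tagnat.sig1 p = tagnat.sig1 q.
  have [/lt12|/lt12|] := ltngtP (pi (tagnat.sig1 p)) (pi (tagnat.sig1 q)).
  - by rewrite eqpq ltnn.
  - by rewrite eqpq ltnn.
  - by move=> /val_inj /perm_inj.
apply: tagnat.sig_inj; rewrite !tagnat.sigE12.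
move: eqpq; rewrite /inflate_val.
case: _ / e1 (tagnat.sig2 q) => j /addnI /val_inj /perm_inj -> //.
Qed.

Definition inflate : 'S_(\sum_i m i) := perm inflate_fun_inj.

Lemma inflateE i (j : 'I_(m i)) :
  inflate (tagnat.Rank i j) = \sum_(i' | pi i' < pi i) m i' + alpha i j :> nat.
Proof.
rewrite permE /= /inflate_val /tagnat.sig1 /tagnat.sig2 /tagnat.Rank.
by rewrite tagnat.rankK.
Qed.

End Inflation.

Inductive blockwise_simple : forall n, 'S_n -> Prop :=
| blockwise_simple1 : blockwise_simple (1%g : 'S_1)
| blockwise_simple_inflate k (pi : 'S_k) (m : 'I_k -> nat)
    (alpha : forall i, 'S_(m i)) :
    4 <= k -> simple_perm pi -> (forall i, 0 < m i) ->
    (forall i, blockwise_simple (alpha i)) ->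
    blockwise_simple (inflate pi alpha).

(* Main.v *)
Require Import Defs.
From mathcomp Require Import all_boot all_order all_algebra all_fingroup.
Local Open Scope ring_scope.

(** Since [pi] is simple and [4 <= k], the set of blocks met by an interval is
    an interval of [pi], hence an interval not inside a block meets every block.
    A block it does not contain would have to be extremal both in position and
    in value, and its complement would be a proper interval of [pi]. So each
    nonempty interval other than the whole set lies in exactly one block, the
    blocks are the coatoms, and the Moebius function is computed by the
    recurrence on its first argument. *)

Set Implicit Arguments.
Unset Strict Implicit.
Unset Printing Implicit Defensive.

Import Order.TTheory GRing.Theory.

Section MobiusDual.
Context {disp : Order.disp_t} {T : finPOrderType disp}.
Implicit Types x y z : T.

Lemma sum_mobius x y :
  \sum_(z : T | (z <= y)%O) mobius x z = (x == y)%:R.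
Proof.
have cut P : \sum_(z : T | P z) mobius x z
           = \sum_(z : T | P z && (x <= z)%O) mobius x z.
  rewrite (bigID (fun z => (x <= z)%O)) /= [X in _ + X]big1 ?addr0 //.
  by move=> z /andP[_]; exact: mobius_nle.
rewrite cut; have [<-|neq] := eqVneq x y.
  rewrite (bigD1 x) ?lexx //= big1 ?addr0 ?mobiusxx // => z.
  by rewrite -eq_le => /andP[/eqP->]; rewrite eqxx.
have [xy|nxy] := boolP (x <= y)%O; last first.
  rewrite big1 // => z /andP[zy xz].
  by rewrite (le_trans xz zy) in nxy.
have ltxy : (x < y)%O by rewrite lt_neqAle neq.
rewrite (bigD1 y) ?lexx //= (mobius_lt ltxy) addrC; apply/eqP.
rewrite subr_eq0; apply/eqP/eq_bigl => z.
by rewrite (lt_neqAle z); case: (z != y); rewrite ?andbT ?andbF //= andbC.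
Qed.

Lemma sum_mobius_dual x y :
  \sum_(z : T | (x <= z)%O) mobius z y = (x == y)%:R.
Proof.
pose M := \matrix_(i, j < #|T|) mobius (enum_val i) (enum_val j).
pose Z : 'M[int]_#|T| := \matrix_(i, j) (enum_val i <= enum_val j)%O%:R.
have MZ : M *m Z = 1%:M.
  apply/matrixP => i j; rewrite !mxE -(inj_eq enum_val_inj) -sum_mobius.
  rewrite [RHS]big_mkcond [RHS](reindex _ (onW_bij _ (enum_val_bij T))) /=.
  apply: eq_bigr => l _; rewrite !mxE.
  by case: ifP; rewrite ?mulr1 ?mulr0.
have /matrixP/(_ (enum_rank x) (enum_rank y)) := mulmx1C MZ.
rewrite !mxE (inj_eq enum_rank_inj) => <-.
rewrite big_mkcond (reindex _ (onW_bij _ (enum_val_bij T))) /=.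
apply: eq_bigr => l _; rewrite !mxE !enum_rankK.
by case: ifP; rewrite ?mul1r ?mul0r.
Qed.

Lemma mobius_lt_dual x y : (x < y)%O ->
  mobius x y = - \sum_(z : T | (x < z)%O) mobius z y.
Proof.
move=> xy; have := sum_mobius_dual x y.
rewrite (lt_eqF xy) (bigD1 x) ?lexx //= => /eqP; rewrite addr_eq0 => /eqP->.
by congr (- _); apply: eq_bigl => z; rewrite lt_neqAle andbC eq_sym.
Qed.

End MobiusDual.

Section UniqueCoatom.
Context {disp : Order.disp_t} {T : finTBPOrderType disp}.
Implicit Types x z c : T.

Lemma coatom_lt c z : coatom c -> (c < z)%O -> z = \top%O.
Proof.
case/andP=> _ /existsPn cz ltcz; apply/eqP; apply: contraNT (cz z).
by rewrite ltcz lt_neqAle lex1 andbT.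
Qed.

Lemma mobius_coatom c : coatom c -> mobius c \top%O = -1.
Proof.
move=> cc; have /andP[ltc _] := cc.
rewrite mobius_lt_dual // (bigD1 \top%O) //= mobiusxx big1 ?addr0 // => z.
by case/andP=> /(coatom_lt cc)->; rewrite eqxx.
Qed.

Hypothesis below_coatom : forall x, x <> \bot%O -> x <> \top%O ->
  exists c, [/\ coatom c, (x <= c)%O &
    forall c', coatom c' -> (x <= c')%O -> c' = c].

Lemma mobius_below_coatom x : x <> \bot%O -> x <> \top%O -> ~~ coatom x ->
  mobius x \top%O = 0.
Proof.
have [d] := ubnP #|[pred z | (x < z)%O]|; elim: d x => // d IHd x.
rewrite ltnS => ltd x0 x1 ncx.
have [c [cc lexc uc]] := below_coatom x0 x1.
have ltxc : (x < c)%O.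
  by rewrite lt_neqAle lexc andbT; apply: contraNneq ncx => ->.
have ltc1 : (c < \top)%O by case/andP: cc.
have ltx1 := lt_trans ltxc ltc1.
rewrite mobius_lt_dual // (bigD1 \top%O) // (bigD1 c) /=; last first.
  by rewrite ltxc (lt_eqF ltc1).
rewrite mobiusxx mobius_coatom // addNKr ?oppr0 big1 ?oppr0 //.
move=> z /andP[/andP[ltxz /eqP z1] zc]; apply: IHd => //.
- apply: leq_trans ltd; apply: proper_card; apply/properP; split.
    by apply/subsetP => t; rewrite !inE; exact: lt_trans.
  by exists z; rewrite !inE ?ltxx.
- by move=> z0; move: ltxz; rewrite z0 ltx0.
- by apply: contraNN zc => cz; rewrite (uc z cz (ltW ltxz)).
Qed.

Lemma mobius_bot_coatom : (\bot : T)%O <> \top%O -> ~~ coatom (\bot : T)%O ->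
  mobius (\bot : T)%O \top%O = #|[pred c : T | coatom c]|%:Z - 1.
Proof.
move=> n01 nc0.
have lt01 : ((\bot : T) < \top)%O by rewrite lt_neqAle le0x andbT; apply/eqP.
rewrite mobius_lt_dual // (bigD1 \top%O) //= mobiusxx.
rewrite (bigID (fun c => coatom c)) /= [X in _ + (_ + X)]big1; last first.
  move=> z /andP[/andP[lt0z /eqP z1] ncz]; apply: mobius_below_coatom => //.
  by move=> z0; rewrite z0 ltxx in lt0z.
rewrite addr0 (eq_bigr (fun _ => -1)); last first.
  by move=> c /andP[_]; exact: mobius_coatom.
rewrite (eq_bigl (fun c => coatom c)); last first.
  move=> c /=; case cc: (coatom c); rewrite ?andbF // andbT.
  rewrite lt0x; apply/andP; split.
    by apply: contraNneq nc0 => <-.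
  by apply/eqP => c1; move: cc; rewrite c1 /coatom /covers ltxx.
by rewrite sumr_const mulNrn opprD opprK addrC natz.
Qed.

End UniqueCoatom.

Definition convex n (A : {set 'I_n}) : Prop :=
  forall x y z : 'I_n, x \in A -> z \in A -> (x <= y <= z)%N -> y \in A.

Lemma segment_convex n (a b : 'I_n) : convex (segment a b).
Proof.
move=> x y z; rewrite !inE => /andP[ax _] /andP[_ zb] /andP[xy yz].
by rewrite (leq_trans ax xy) (leq_trans yz zb).
Qed.

Lemma convex_segment n (A : {set 'I_n}) : A != set0 -> convex A ->
  exists a b : 'I_n, (a <= b)%N /\ A = segment a b.
Proof.
case/set0Pn=> x0 Ax0 cA.
case: (arg_minnP (fun x : 'I_n => nat_of_ord x) Ax0) => a Aa mina.
case: (arg_maxnP (fun x : 'I_n => nat_of_ord x) Ax0) => b Ab maxb.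
exists a, b; split; first exact: mina.
apply/setP => y; rewrite inE; apply/idP/idP => [Ay|]; last exact: cA.
by apply/andP; split; [exact: mina|exact: maxb].
Qed.

Lemma is_intervalP n (s : 'S_n) (A : {set 'I_n}) :
  reflect [/\ A != set0, convex A & convex (s @^-1: A)] (is_interval s A).
Proof.
apply: (iffP andP) => [[/existsP[i /existsP[j /andP[ij /eqP ->]]]]|].
  case/existsP=> a /existsP[b /eqP Eab]; split.
  - by apply/set0Pn; exists (s i); rewrite imset_f // inE leqnn.
  - by rewrite Eab; exact: segment_convex.
  - have -> : s @^-1: (s @: segment i j) = segment i j.
      by apply/setP => x; rewrite inE mem_imset //; exact: perm_inj.
    exact: segment_convex.
case=> A0 cA cB; split; last first.
  have [a [b [_ ->]]] := convex_segment A0 cA.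
  by apply/existsP; exists a; apply/existsP; exists b.
have B0 : s @^-1: A != set0.
  by have /set0Pn[x Ax] := A0; apply/set0Pn; exists (s^-1%g x); rewrite inE permKV.
have [i [j [ij E]]] := convex_segment B0 cB.
apply/existsP; exists i; apply/existsP; exists j; rewrite ij -E /=.
apply/eqP/setP => x; apply/idP/imsetP => [Ax|[y]].
  by exists (s^-1%g x); rewrite ?inE permKV.
by rewrite inE => Ay ->.
Qed.

(* The inflation enters only through the map [f] from positions to blocks. *)
Section Blocks.
Variables (n k : nat) (s : 'S_n) (pi : 'S_k) (f : 'I_n -> 'I_k).
Hypothesis f_homo : forall p q : 'I_n, (p <= q)%N -> (f p <= f q)%N.
Hypothesis pif_homo :
  forall p q : 'I_n, (s p <= s q)%N -> (pi (f p) <= pi (f q))%N.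
Hypothesis f_surj : forall i, exists p, f p = i.
Hypothesis k_ge4 : (4 <= k)%N.
Hypothesis pi_simple : simple_perm pi.

Definition block i : {set 'I_n} := s @: (f @^-1: [set i]).

Lemma mem_block i p : (s p \in block i) = (f p == i).
Proof. by rewrite mem_imset ?inE //; exact: perm_inj. Qed.

Lemma block_is_interval i : is_interval s (block i).
Proof.
apply/is_intervalP; split.
- by have [p fp] := f_surj i; apply/set0Pn; exists (s p); rewrite mem_block fp.
- move=> x y z; rewrite -[x](permKV s) -[y](permKV s) -[z](permKV s).
  rewrite !mem_block => /eqP fx /eqP fz /andP[/pif_homo xy /pif_homo yz].
  rewrite -(inj_eq (@perm_inj _ pi)) -val_eqE eqn_leq /=.
  by move: xy yz; rewrite fx fz => -> ->.
- move=> x y z; rewrite !inE !mem_block => /eqP fx /eqP fz.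
  case/andP=> /f_homo xy /f_homo yz; rewrite -val_eqE eqn_leq /=.
  by move: xy yz; rewrite fx fz => -> ->.
Qed.

Lemma f_lt p q : (f p < f q)%N -> (p < q)%N.
Proof. by rewrite !ltnNge; apply: contraNN; exact: f_homo. Qed.

Lemma pif_lt p q : (pi (f p) < pi (f q))%N -> (s p < s q)%N.
Proof. by rewrite !ltnNge; apply: contraNN; exact: pif_homo. Qed.

Lemma simple_interval (A : {set 'I_k}) :
  is_interval pi A -> (1 < #|A|)%N -> A = setT.
Proof.
move=> iA cA; apply/eqP; have /forallP/(_ A) := pi_simple.
by rewrite /proper_interval iA (gtn_eqF cA) andbT negbK.
Qed.

Lemma mem_between (C : {set 'I_k}) (x y z : 'I_k) :
  x \in C -> z \in C -> (x <= y <= z)%N -> y \notin C -> (x < y < z)%N.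
Proof.
move=> Cx Cz /andP[xy yz] Cy; rewrite !ltn_neqAle xy yz !andbT.
by apply/andP; split; apply: contraNneq Cy => /val_inj; [move<-|move->].
Qed.

Section CrossingInterval.
Variable J : {set 'I_n}.
Hypothesis J_interval : is_interval s J.
Variables p q : 'I_n.
Hypotheses (Jp : s p \in J) (Jq : s q \in J) (fpq : f p != f q).

Lemma crossing_meets i : exists2 r, s r \in J & f r = i.
Proof.
have [_ cJ cpJ] := is_intervalP _ _ J_interval.
pose C := [set pi (f r) | r in s @^-1: J].
suff CT : C = setT.
  have := in_setT (pi i); rewrite -CT => /imsetP[r]; rewrite inE => Jr /perm_inj.
  by exists r.
have Cpi r : s r \in J -> pi (f r) \in C.
  by move=> Jr; apply/imsetP; exists r; rewrite ?inE.
apply: simple_interval; last first.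
  by apply/card_gt1P; exists (pi (f p)), (pi (f q)); rewrite !Cpi ?(inj_eq perm_inj).
apply/is_intervalP; split; first by apply/set0Pn; exists (pi (f p)); exact: Cpi.
- move=> x y z Cx Cz xyz; apply/negPn/negP => Cy.
  have /andP[] := mem_between Cx Cz xyz Cy.
  case/imsetP: Cx => u; rewrite inE => Ju ->.
  case/imsetP: Cz => w; rewrite inE => Jw ->.
  have [v Ev] := f_surj (pi^-1%g y); rewrite -[y](permKV pi) -Ev in Cy *.
  move=> /pif_lt/ltnW uv /pif_lt/ltnW vw; case/negP: Cy; apply: Cpi.
  by apply: (cJ _ _ _ Ju Jw); rewrite uv.
- move=> x y z; rewrite !inE => Cx Cz xyz; apply/negPn/negP => Cy.
  have /andP[] : (x < y < z)%N.
    by apply: (@mem_between (pi @^-1: C)) => //; rewrite inE.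
  case/imsetP: Cx => u; rewrite inE => Ju /perm_inj->.
  case/imsetP: Cz => w; rewrite inE => Jw /perm_inj->.
  have [v Ev] := f_surj y; rewrite -Ev in Cy *.
  move=> /f_lt/ltnW uv /f_lt/ltnW vw; case/negP: Cy; apply: Cpi.
  have := cpJ u v w; rewrite !inE; apply=> //.
  by rewrite uv.
Qed.

Lemma crossing_full : J = setT.
Proof.
have [_ cJ cpJ] := is_intervalP _ _ J_interval.
apply/setP => x; rewrite inE; apply/negPn/negP; rewrite -[x](permKV s).
move: (s^-1%g x) => r Jr.
have gt1 : (1 < #|[set~ pi (f r)]|)%N.
  by rewrite cardsC1 card_ord -subn1 ltn_subRL (leq_trans _ k_ge4).
suff iC : is_interval pi [set~ pi (f r)].
  by have := in_setT (pi (f r)); rewrite -(simple_interval iC gt1) !inE eqxx.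
apply/is_intervalP; split; first by rewrite -card_gt0 ltnW.
- move=> x' y z; rewrite !inE => Cx Cz xyz; apply/negP => /eqP Ey; subst y.
  have := @mem_between [set~ pi (f r)] x' _ z.
  rewrite !inE => /(_ _ Cx Cz xyz); rewrite !inE eqxx => /(_ isT).
  have [u Ju Eu] := crossing_meets (pi^-1%g x').
  have [w Jw Ew] := crossing_meets (pi^-1%g z).
  rewrite -[x'](permKV pi) -[z](permKV pi) -Eu -Ew.
  case/andP=> /pif_lt/ltnW ur /pif_lt/ltnW rw.
  by case/negP: Jr; apply: (cJ _ _ _ Ju Jw); rewrite ur.
- move=> x' y z; rewrite !inE !(inj_eq perm_inj) => Cx Cz xyz; apply/negP => /eqP Ey; subst y.
  have := @mem_between [set~ f r] x' _ z.
  rewrite !inE => /(_ _ Cx Cz xyz); rewrite !inE eqxx => /(_ isT).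
  have [u Ju <-] := crossing_meets x'.
  have [w Jw <-] := crossing_meets z.
  case/andP=> /f_lt/ltnW ur /f_lt/ltnW rw.
  case/negP: Jr; have := cpJ u r w; rewrite !inE; apply=> //.
  by rewrite ur.
Qed.

End CrossingInterval.

Lemma interval_sub_block J : is_interval s J -> J <> setT ->
  exists i, J \subset block i.
Proof.
move=> iJ nJ; have [/set0Pn[x]] := is_intervalP _ _ iJ.
rewrite -[x](permKV s); move: (s^-1%g x) => p Jp _ _; exists (f p).
apply/subsetP => y; rewrite -[y](permKV s) mem_block; move: (s^-1%g y) => q Jq.
by apply/negPn/negP => /(crossing_full iJ Jq Jp).
Qed.

Lemma block_poset_subproof i : (block i == set0) || is_interval s (block i).
Proof. by rewrite block_is_interval orbT. Qed.

Definition block_elt i : interval_poset s :=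
  IntervalPoset (block_poset_subproof i).

Lemma block_meet_inj i j x : x \in block i -> x \in block j -> i = j.
Proof. by rewrite -[x](permKV s) !mem_block => /eqP<- /eqP. Qed.

Lemma block_neq0 i : block i != set0.
Proof. by have [] := is_intervalP _ _ (block_is_interval i). Qed.

Lemma block_subset_inj i j : block i \subset block j -> i = j.
Proof.
have /set0Pn[x ix] := block_neq0 i.
by move/subsetP/(_ _ ix); exact: block_meet_inj.
Qed.

Lemma block_neqT i : block i != setT.
Proof.
have [j ji] : exists j, j != i.
  have: (0 < #|[set~ i]|)%N.
    by rewrite cardsC1 card_ord -subn1 subn_gt0 (leq_trans _ k_ge4).
  by case/card_gt0P=> j; rewrite !inE; exists j.
apply: contraNneq ji => Ei; apply/eqP/block_subset_inj.
by rewrite Ei subsetT.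
Qed.

Lemma interval_elt_le_block (I : interval_poset s) :
  I <> \bot%O -> I <> \top%O -> exists i, (I <= block_elt i)%O.
Proof.
move=> I0 I1; have iI : is_interval s I.
  case: I I0 {I1} => A pA A0 /=; case/orP: (pA) => // /eqP EA.
  by case: A0; apply: val_inj.
by apply: interval_sub_block => // IT; apply: I1; apply: val_inj.
Qed.

Lemma coatom_block_elt i : coatom (block_elt i).
Proof.
apply/andP; split.
  rewrite lt_neqAle lex1 andbT; apply: contraNneq (block_neqT i).
  by move=> Ei; apply/eqP; exact: (congr1 (@interval_set _ s) Ei).
apply/existsPn => I; apply/negP => /andP[iI I1].
have [|I1'|j Ij] := @interval_elt_le_block I.
- by move=> I0; move: iI; rewrite I0 ltx0.
- by rewrite I1' ltxx in I1.
have Eij : i = j := block_subset_inj (le_trans (ltW iI) Ij).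
by rewrite -Eij in Ij; rewrite (lt_geF iI) in Ij.
Qed.

Lemma block_elt_neq_bot i : block_elt i != \bot%O.
Proof.
by apply: contraNneq (block_neq0 i) => /(congr1 (@interval_set _ s)) /= ->.
Qed.

Lemma not_coatom_bot : ~~ coatom (\bot : interval_poset s)%O.
Proof.
have i : 'I_k := Ordinal (leq_trans (isT : (0 < 4)%N) k_ge4).
have /andP[i1 _] := coatom_block_elt i.
apply/negP => /andP[_] /existsPn/(_ (block_elt i)).
by rewrite lt0x block_elt_neq_bot i1.
Qed.

Lemma coatomP (I : interval_poset s) :
  reflect (exists i, I = block_elt i) (coatom I).
Proof.
apply: (iffP idP) => [cI|[i ->]]; last exact: coatom_block_elt.
have [|I1|i Ii] := @interval_elt_le_block I.
- by move=> I0; move: cI; rewrite I0 (negPf not_coatom_bot).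
- by move: cI; rewrite I1 /coatom /covers ltxx.
exists i; apply/eqP/negPn/negP => nIi; have := coatom_block_elt i.
rewrite (coatom_lt (z := block_elt i) cI) ?lt_neqAle ?nIi //.
by rewrite /coatom /covers ltxx.
Qed.

Lemma card_coatom : #|[pred I : interval_poset s | coatom I]| = k.
Proof.
have inj : injective block_elt.
  move=> i j /(congr1 (@interval_set _ s)) /= Eij.
  by apply: block_subset_inj; rewrite Eij.
rewrite -[RHS]card_ord -(card_codom inj); apply: eq_card => I.
by rewrite inE; apply/coatomP/codomP.
Qed.

Lemma below_block_elt (I : interval_poset s) : I <> \bot%O -> I <> \top%O ->
  exists c, [/\ coatom c, (I <= c)%O &
    forall c', coatom c' -> (I <= c')%O -> c' = c].
Proof.
move=> I0 I1; have [i Ii] := interval_elt_le_block I0 I1.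
exists (block_elt i); split=> //; first exact: coatom_block_elt.
move=> _ /coatomP[j ->] Ij; congr block_elt.
have : interval_set I != set0 by apply/eqP => I0'; apply: I0; apply: val_inj.
case/set0Pn=> x Ix.
by apply: (@block_meet_inj _ _ x); [apply: (subsetP Ij)|apply: (subsetP Ii)].
Qed.

End Blocks.

Section InflationBlocks.
Variables (k : nat) (pi : 'S_k) (m : 'I_k -> nat) (alpha : forall i, 'S_(m i)).

Lemma inflate_homo (p q : 'I_(\sum_i m i)) :
  (inflate pi alpha p <= inflate pi alpha q)%N ->
  (pi (tagnat.sig1 p) <= pi (tagnat.sig1 q))%N.
Proof.
rewrite !permE /= /inflate_val; apply: contraLR; rewrite -!ltnNge => lt.
apply: ltn_addr.
rewrite [ltnRHS](bigID [pred i | (pi i < pi (tagnat.sig1 q))%N]) /=.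
rewrite [X in (_ < X + _)%N](eq_bigl (fun i => pi i < pi (tagnat.sig1 q))%N);
  last first.
  move=> i /=; case: (ltnP (pi i) (pi (tagnat.sig1 q))) => h.
    by rewrite (ltn_trans h lt).
  by rewrite andbF.
by rewrite ltn_add2l (bigD1 (tagnat.sig1 q)) ?ltnn ?lt //= ltn_addr.
Qed.

End InflationBlocks.

Theorem proposition4p8 (k : nat) (pi : 'S_k) (m : 'I_k -> nat)
    (alpha : forall i : 'I_k, 'S_(m i))
    (hk : (4 <= k)%N) (hpi : simple_perm pi)
    (hm : forall i : 'I_k, (0 < m i)%N)
    (halpha : forall i : 'I_k, blockwise_simple (alpha i))
    (I : interval_poset (inflate pi alpha)) :
  [/\ I = \top%O -> mobius I \top%O = 1,
      coatom I -> mobius I \top%O = -1,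
      I = \bot%O -> mobius I \top%O = k%:Z - 1
    & I <> \top%O -> ~~ coatom I -> I <> \bot%O -> mobius I \top%O = 0].
Proof.
have f_surj (i : 'I_k) : exists p : 'I_(\sum_i m i), tagnat.sig1 p = i.
  by exists (tagnat.Rank i (Ordinal (hm i))); rewrite tagnat.Rank1K.
have f_homo := @tagnat.le_sig1 k m; have pif_homo := @inflate_homo k pi m alpha.
have below := below_block_elt f_homo pif_homo f_surj hk hpi.
have nc0 := not_coatom_bot f_homo pif_homo f_surj hk hpi.
split=> [->|/mobius_coatom//|->|I1 cI I0].
- exact: mobiusxx.
- rewrite mobius_bot_coatom // ?(card_coatom f_homo pif_homo f_surj hk hpi) //.
  have [p _] := f_surj (Ordinal (leq_trans (isT : (0 < 4)%N) hk)).
  by move=> /(congr1 (@interval_set _ _)) /= /setP/(_ p); rewrite !inE.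
- exact: mobius_below_coatom.
Qed.
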